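(* Let $q>2$ be a prime power, let $l\in\mathbb{N}$ and let $P_1<\dots<P_l$ be the primes that divide $q-1$. Then the coatoms of the lattice of monomial clones on $\mathbb{F}_q$ are given by $\langle\{x_1\cdots x_{1+P_i}\}\rangle$ for $i\le l$, and by $\mathcal{S}_q(D)$ for each nonempty $D\subseteq\{1,\dots,l\}$.
   Context: $\mathbb{N}=\{1,2,\dots\}$, $\mathbb{N}_0=\mathbb{N}\cup\{0\}$, $\mathbb{F}_q$ is the field with $q$ elements. A monomial is a formal product $g=\prod_{i\in\mathbb{N}}x_i^{\alpha(i)}$ with $\alpha(i)\in\mathbb{N}_0$, finitely many but at least one $\alpha(i)$ nonzero (so $1$ is not a monomial); $\mathrm{mI}(g)$ is the largest $i$ with $\alpha(i)\neq0$, called the arity of $g$. For $n\ge\mathrm{mI}(g)$ the $n$-ary induced function is $g^{\mathbb{F}_q^n}\colon\mathbb{F}_q^n\to\mathbb{F}_q$, $(x_1,\dots,x_n)\mapsto\prod_{i=1}^nx_i^{\alpha(i)}$. Monomials $m_1,m_2$ are equivalent if the $\mathrm{mI}(m_1)$-ary induced function of $m_1$ equals the $\mathrm{mI}(m_2)$-ary induced function of $m_2$ (i.e. for each $i$ the exponents of $x_i$ in $m_1$ and $m_2$ are equal, or both positive and congruent modulo $q-1$). A clone on a set $A$ is a set of finitary operations on $A$ (of arities $\ge1$) containing all projections and closed under composition. A set $M$ of monomials is a monomial clone on $\mathbb{F}_q$ if $\{m^{\mathbb{F}_q^n}\mid m\in M,\ n\ge\mathrm{mI}(m)\}$ is a clone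 on $\mathbb{F}_q$ and $M$ is closed under equivalent monomials. For a set $M'$ of monomials, $\langle M'\rangle$ is the least monomial clone on $\mathbb{F}_q$ containing $M'$. The set of all monomial clones on $\mathbb{F}_q$, ordered by inclusion, is a lattice with least element $\Delta=\langle\{x_1\}\rangle$ and largest element $\nabla=\langle\{x_1x_2\}\rangle$. A coatom is a monomial clone $C$ with $C\neq\Delta$ and $C\neq\nabla$ such that every monomial clone $D\supseteq C$ satisfies $D=\nabla$ or $D=C$. For nonempty $D\subseteq\{1,\dots,l\}$, $$\mathcal{S}_q(D):=\langle\{x_1^t,\ x_1^{P_i}\cdots x_n^{P_i},\ x_1x_2^{T}\mid n,t\in\mathbb{N},\ i\in D\}\rangle,\qquad T:=\prod_{t\in D}P_t.$$ *)

(* Defs.v *)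
From mathcomp Require Import all_boot all_order all_algebra.
From mathcomp Require Import finmap monalg.
From mathcomp Require Import boolp classical_sets.

Set Implicit Arguments.
Unset Strict Implicit.
Unset Printing Implicit Defensive.

Import GRing.Theory.

Local Open Scope classical_set_scope.
Local Open Scope nat_scope.

(* Variables are numbered from 0: [expo m i] is the exponent of x_(i+1) in m. *)
Definition monomial := {m : {cmonom nat} | m != mone}.

Definition expo (m : monomial) (i : nat) : nat := sval m i.

Definition arity (m : monomial) : nat := \max_(i <- finsupp (sval m)) i.+1.

(* [mono [:: a_1; ..; a_k]] is the singleton {x_1^a_1 ... x_k^a_k}, or empty
   when all the a_i are zero; see [mono_singleton]. *)
Definition mono (a : seq nat) : set monomial :=
  [set m | forall i, expo m i = nth 0 a i].

Definition operation (A : Type) (n : nat) : Type := n.-tuple A -> A.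

(* A set of finitary operations is given by its n-ary part for every n; arities
   are positive, so the nullary part of a clone is empty. *)
Definition is_clone (A : Type) (C : forall n, set (operation A n)) : Prop :=
  [/\ C 0 = set0,
      forall n (i : 'I_n), C n (fun x => tnth x i)
    & forall n k (f : operation A n) (g : 'I_n -> operation A k),
        C n f -> (forall i, C k (g i)) ->
        C k (fun x => f [tuple g i x | i < n])].

Section MonomialClones.
Variable F : finFieldType.

(* Meant for [arity m <= n] only. *)
Definition induced (n : nat) (m : monomial) : operation F n :=
  fun x => (\prod_(i < n) tnth x i ^+ expo m i)%R.

Definition induced_ops (M : set monomial) n : set (operation F n) :=
  [set (induced m : operation F n) | m in [set m | M m /\ arity m <= n]].

Definition mono_equiv (m1 m2 : monomial) : Prop :=
  arity m1 = arity m2 /\ induced m1 = induced m2 :> operation F (arity m1).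

Definition monomial_clone (M : set monomial) : Prop :=
  is_clone (induced_ops M) /\
  (forall m1 m2, mono_equiv m1 m2 -> M m1 -> M m2).

(* The intersection of the monomial clones containing M; it is itself a
   monomial clone, see [generated_clone]. *)
Definition generated (M : set monomial) : set monomial :=
  smallest monomial_clone M.

Definition Delta : set monomial := generated (mono [:: 1]).
Definition Nabla : set monomial := generated (mono [:: 1; 1]).

Definition coatom (C : set monomial) : Prop :=
  [/\ monomial_clone C, C <> Delta, C <> Nabla
    & forall D, monomial_clone D -> C `<=` D -> D = Nabla \/ D = C].

Definition Sclone (l : nat) (P : 'I_l -> nat) (D : {set 'I_l}) : set monomial :=
  generated
    ([set m | exists2 t, 0 < t & mono [:: t] m] `|`
     [set m | exists n i, [/\ 0 < n, i \in D & mono (nseq n (P i)) m]] `|`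
     mono [:: 1; \prod_(i in D) P i]).

End MonomialClones.

Section Facts.

Lemma monomial_eqP (m1 m2 : monomial) : expo m1 =1 expo m2 -> m1 = m2.
Proof. by move=> e; apply/val_inj/val_inj/fsfunP => i; exact: e. Qed.

Lemma expo_neq0 (m : monomial) : exists i, expo m i != 0.
Proof.
case: (pselect (exists i, expo m i != 0)) => // e0.
have /negP[] := proj2_sig m; apply/eqP/val_inj/fsfunP => i; rewrite [RHS]cm1.
by apply: contra_notP e0 => /eqP; exists i.
Qed.

Lemma arity_gt (m : monomial) i : expo m i != 0 -> i < arity m.
Proof.
move=> mi; rewrite /arity (big_rem i) /= ?leq_max ?leqnn //.
by rewrite mem_finsupp.
Qed.

Lemma arity_leP (m : monomial) n :
  reflect (forall i, n <= i -> expo m i = 0) (arity m <= n).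
Proof.
apply: (iffP idP) => [mn i ni|m0].
  by apply/eqP; apply: contraLR ni => /arity_gt; rewrite -ltnNge => /leq_trans->.
rewrite /arity; apply/bigmax_leqP_seq => i; rewrite mem_finsupp => mi _.
by rewrite ltnNge; apply: contra mi => /m0 /eqP.
Qed.

Lemma mono_singleton (a : seq nat) :
  has (fun e => e != 0) a -> exists m, mono a = [set m].
Proof.
move=> ha.
pose c : {cmonom nat} :=
  mkcmonom [fsfun i in [fset i | i in iota 0 (size a)]%fset => nth 0 a i | 0].
have cE i : c i = nth 0 a i.
  rewrite /c cmE /= fsfunE; case: ifP => //.
  rewrite in_fset /= => /negbT.
  by rewrite mem_iota add0n /= -leqNgt => ?; rewrite nth_default.
have c1 : c != mone.
  apply/eqP => c1; move: ha => /hasP[e /(nthP 0)[i _ <-]].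
  by rewrite -cE c1 cm1 eqxx.
exists (exist _ c c1); apply/seteqP; split => [m /= mE|m /= -> //].
by apply: monomial_eqP => i; rewrite mE -cE.
Qed.

Variable F : finFieldType.

Lemma induced_widen (m : monomial) k n (x : k.-tuple F) :
  arity m <= k <= n ->
  induced m x = induced m [tuple (nth 0 x i)%R | i < n].
Proof.
case/andP => /arity_leP mk kn; rewrite /induced.
under eq_bigr do rewrite (tnth_nth 0%R).
under [RHS]eq_bigr do rewrite tnth_mktuple.
rewrite (big_ord_widen n (fun i => x`_i ^+ expo m i)%R kn) big_mkcond /=.
by apply: eq_bigr => i _; case: ltnP => // /mk ->; rewrite expr0.
Qed.

Lemma induced_inj n (m1 m2 : monomial) : arity m1 <= n -> arity m2 <= n ->
  induced m1 = induced m2 :> operation F n -> mono_equiv F m1 m2.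
Proof.
move=> m1n m2n m12.
have E i : (expo m1 i == 0) = (expo m2 i == 0).
  case: (ltnP i n) => [ltin|ni]; last first.
    by rewrite (arity_leP _ _ m1n) // (arity_leP _ _ m2n).
  have ev (m : monomial) :
      induced m [tuple ((j != Ordinal ltin)%:R : F)%R | j < n]
      = ((expo m i == 0)%:R)%R.
    rewrite /induced (bigD1 (Ordinal ltin)) //= tnth_mktuple eqxx expr0n.
    rewrite big1 ?mulr1 // => j /negPf ji.
    by rewrite tnth_mktuple ji expr1n.
  have /eqP := ev m1; rewrite m12 ev.
  by case: (expo m1 i == 0); case: (expo m2 i == 0);
    rewrite //= ?oner_eq0 // eq_sym oner_eq0.
have leA (m m' : monomial) :
    (forall i, (expo m i == 0) = (expo m' i == 0)) -> arity m <= arity m'.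
  move=> e; apply/arity_leP => i im.
  by apply/eqP; rewrite e; apply/eqP; apply/arity_leP: im.
have a12 : arity m1 = arity m2.
  by apply/eqP; rewrite eqn_leq !leA.
split=> //; apply/funext => x.
have m1a : arity m1 <= arity m1 <= n by rewrite leqnn.
have m2a : arity m2 <= arity m1 <= n by rewrite -a12 leqnn.
by rewrite (induced_widen x m1a) (induced_widen x m2a) m12.
Qed.

Lemma induced_proj n (i : 'I_n) : exists m : monomial,
  arity m <= n /\ induced m = (fun x : n.-tuple F => tnth x i).
Proof.
have [|m mE] := @mono_singleton (mkseq (fun j => (j == i) : nat) n).
  by apply/hasP; exists 1 => //; apply/mapP; exists (i : nat);
    rewrite ?eqxx // mem_iota /=.
have {}mE : mono (mkseq (fun j => (j == i) : nat) n) m by rewrite mE.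
exists m; split.
  by apply/arity_leP => j nj; rewrite mE nth_default // size_mkseq.
apply/funext => x; rewrite /induced (bigD1 i) //= mE nth_mkseq // eqxx expr1.
rewrite big1 ?mulr1 // => j ji.
by rewrite mE nth_mkseq // (negPf ji : (j == i :> nat) = false) expr0.
Qed.

Lemma induced_comp n k (m : monomial) (h : 'I_n -> monomial) :
  arity m <= n -> (forall i, arity (h i) <= k) ->
  exists p : monomial, arity p <= k /\
    induced p = (fun x : k.-tuple F => induced m [tuple induced (h i) x | i < n]).
Proof.
move=> mn hk.
pose e j := \sum_(i < n) expo (h i) j * expo m i.
have [|p pE] := @mono_singleton (mkseq e k).
  have [i mi] := expo_neq0 m.
  have ltin : i < n := leq_trans (arity_gt mi) mn.
  have [j hj] := expo_neq0 (h (Ordinal ltin)).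
  have ltjk : j < k := leq_trans (arity_gt hj) (hk _).
  apply/hasP; exists (e j); first by apply/mapP; exists j; rewrite ?mem_iota.
  rewrite /e (bigD1 (Ordinal ltin)) //= addn_eq0 negb_and muln_eq0 negb_or.
  by rewrite hj mi.
have {}pE : mono (mkseq e k) p by rewrite pE.
exists p; split.
  by apply/arity_leP => j kj; rewrite pE nth_default // size_mkseq.
apply/funext => x; rewrite /induced.
under [RHS]eq_bigr do rewrite tnth_mktuple -prodrXl.
rewrite exchange_big /=; apply: eq_bigr => j _.
rewrite pE nth_mkseq // /e expr_sum.
by apply: eq_bigr => i _; rewrite exprM.
Qed.

Lemma generated_clone (M : set monomial) : monomial_clone F (generated F M).
Proof.
have in_gen n (p : monomial) : arity p <= n ->
    (forall C, monomial_clone F C -> M `<=` C ->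
       induced_ops C (induced p : operation F n)) -> generated F M p.
  move=> pn H C [CC MC]; have [m [Cm mn] mp] := H C CC MC.
  by apply: CC.2 Cm; apply: induced_inj mp.
split; last first.
  by move=> m1 m2 m12 H C CM; apply: (CM.1.2 _ _ m12); exact: H.
split.
- rewrite -subset0 => f [m [_ m0] _]; have [i /arity_gt] := expo_neq0 m.
  by move=> /leq_trans/(_ m0).
- move=> n i; have [p [pn pE]] := induced_proj i.
  exists p => //; split=> //; apply: (in_gen n) => // C [[_ Cp _] _] _.
  by rewrite pE.
- move=> n k f g [m [Mm mn] <-{f}] Hg.
  have /choice[h hE] : forall i, exists h : monomial,
      [/\ generated F M h, arity h <= k & induced h = g i].
    by move=> i; have [h [? ?] ?] := Hg i; exists h.
  have [|p [pk pE]] := @induced_comp n k m h mn; first by move=> i; case: (hE i).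
  have {}pE : induced p =
      (fun x : k.-tuple F => induced m [tuple g i x | i < n]).
    rewrite pE; apply/funext => x; congr induced.
    by apply: eq_mktuple => i; case: (hE i) => _ _ ->.
  exists p => //; split=> //; apply: (in_gen k) => // C CC MC.
  rewrite pE; case: (CC) => -[_ _ Cc] _; apply: Cc => [|i].
    by exists m => //; split=> //; exact: Mm.
  by have [hM hk <-] := hE i; exists (h i) => //; split=> //; exact: hM.
Qed.

End Facts.

(* Main.v *)
Require Import Defs.
From mathcomp Require Import all_boot all_order all_algebra.
From mathcomp Require Import cyclic finfield.
From mathcomp Require Import boolp classical_sets.

(** Put N = q - 1 and let p range over its prime divisors. Since F* is cyclic
    of order N, two monomials are equivalent exactly when their exponents
    vanish together and are congruent modulo N. Monomial clones thus become
    sets of exponent vectors that contain the unit vectors and are closed under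
    substitution, where the vector of m(h_1, ..., h_n) is the combination of
    the vectors of the h_i with the exponents of m as coefficients
    ([monomial_cloneP]).

    In these terms < x_1 ... x_(1+p) > consists of the monomials of total
    degree 1 modulo p ([total_clone_generated]), and S_q(D) consists of the
    monomials whose exponents are all divisible by one p in D, or by every p in
    D outside a single variable ([multiple_clone_generated]). Such explicit
    sets are easy to compare, and no two of them are comparable for inclusion
    ([maximal_family_antichain]). So it is enough to show that a clone M lying
    below none of them contains x_1 x_2: every proper clone is then below a
    member of the family, and an antichain with that property is the set of
    coatoms.

    Let U be the multiplicative monoid of the t with x_1^t in M. Fix p and
    suppose that p divides no element of U. Since M is not contained in the
    clone of total degrees 1 modulo p, the image G of U in F_p is a set of
    nonzero residues with at least two elements. If a monomial of M had two
    exponents a, b prime to p, putting powers for its variables would make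
    g |-> a g + (b t + c) a permutation of G for every t in G; comparing the
    sums over G for two values of t gives p | #|G|, which is absurd. Hence M
    would lie below S_q({p}) ([unit_powers_concentrated]). So each p divides
    some element of U, and a product of such elements, raised to a large power,
    gives x_1^N in M ([mem_powerN]). Substituting x_1^N erases a variable
    modulo N.

    Now call a set D of primes good ([unit_on]) when (x_1 x_2)^c is in M for
    some c prime to every p in D. Singletons are good because M is not below
    S_q({p}). Let D be a minimal set that is not good. Its subsets D \ {p} are
    good, and products of powers of the corresponding exponents give, for every
    proper subset S of D, some (x_1 x_2)^c in M with c = 1 modulo the p in S and
    c = 0 modulo the others ([exists_idempotent_pair]). As M is not below
    S_q(D), it has a monomial m in which the elements of D can be distributed
    over the variables, not all to the same one, so that p does not divide the
    exponent of its variable. Substituting in each variable the pair attached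
    to its share of D, corrected by an inverse of its exponent, produces
    (x_1 x_2)^c with c = 1 modulo every p in D, so D was good
    ([unit_on_all]). The set of all p is therefore good, and Euler's theorem
    turns (x_1 x_2)^c into x_1 x_2 ([mem_xy]). *)

Set Implicit Arguments.
Unset Strict Implicit.
Unset Printing Implicit Defensive.

(** * Exponent vectors *)

Section ExponentVectors.

Local Open Scope classical_set_scope.
Local Open Scope nat_scope.

(** For N = |F| - 1: the exponents a and b define the same power map on F. The
    condition at 0 separates x^0 from x^N. *)
Definition exp_equiv (N a b : nat) : Prop := (a == 0) = (b == 0) /\ a = b %[mod N].

(** Monomial clones without operations. Substitution is closed up to
    equivalence of exponents, so that the single second clause also gives
    closure under equivalent monomials (see [exp_clone_equiv]). *)
Definition exp_clone (N : nat) (M : set monomial) : Prop :=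
  (forall i m, (forall j, expo m j = (j == i)) -> M m) /\
  (forall m (h : nat -> monomial) p, M m -> (forall i, M (h i)) ->
     (forall j, exp_equiv N (expo p j)
                  (\sum_(i < arity m) expo m i * expo (h i) j)) -> M p).

Lemma exp_equiv_refl N a : exp_equiv N a a.
Proof. by []. Qed.

Lemma exp_equiv_sym N a b : exp_equiv N a b -> exp_equiv N b a.
Proof. by case=> e0 e; split; rewrite ?e0 ?e. Qed.

Lemma exp_equiv_pos N a b : 0 < a -> 0 < b -> a = b %[mod N] -> exp_equiv N a b.
Proof. by rewrite !lt0n /exp_equiv => /negPf-> /negPf->. Qed.

Lemma exists_monomial (a : nat -> nat) n :
  (forall i, n <= i -> a i = 0) -> (exists i, a i != 0) ->
  exists m, expo m =1 a.
Proof.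
move=> an [i ai]; have lt_in : i < n by rewrite ltnNge; apply: contra ai => /an ->.
have [|m mE] := @mono_singleton (mkseq a n).
  by apply/hasP; exists (a i) => //; apply: map_f; rewrite mem_iota.
have {}mE : mono (mkseq a n) m by rewrite mE.
exists m => j; rewrite mE.
case: (ltnP j n) => nj; first by rewrite nth_mkseq.
by rewrite nth_default ?size_mkseq // an.
Qed.

Lemma exists_variable i : exists m, forall j, expo m j = (j == i).
Proof.
apply: (@exists_monomial (fun j => (j == i) : nat) i.+1); last first.
  by exists i; rewrite eqxx.
by move=> j ij; rewrite gtn_eqF.
Qed.

Lemma expo_arity (m : monomial) i : arity m <= i -> expo m i = 0.
Proof. by move: i; apply/arity_leP. Qed.

Lemma sum_expo_widen (m : monomial) n (f : nat -> nat) : arity m <= n ->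
  \sum_(i < n) expo m i * f i = \sum_(i < arity m) expo m i * f i.
Proof.
move=> mn; rewrite (big_ord_widen n (fun i => expo m i * f i) mn) [RHS]big_mkcond.
by apply: eq_bigr => i _; case: ltnP => // /expo_arity ->.
Qed.

(** No cancellation can occur among natural exponents, hence substituting
    monomials in a monomial never yields the constant 1. *)
Lemma substitution_neq0 m (h : nat -> monomial) :
  exists j, \sum_(i < arity m) expo m i * expo (h i) j != 0.
Proof.
have [i mi] := expo_neq0 m; have [j hj] := expo_neq0 (h i); exists j.
rewrite (bigD1 (Ordinal (arity_gt mi))) //= addn_eq0 negb_and muln_eq0 negb_or.
by rewrite mi hj.
Qed.

Lemma substitution_eq0 m (h : nat -> monomial) j :
  \max_(i < arity m) arity (h i) <= j ->
  \sum_(i < arity m) expo m i * expo (h i) j = 0.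
Proof.
move=> hj; apply: big1 => i _; rewrite (@expo_arity (h i)) ?muln0 //.
exact: leq_trans (leq_bigmax i) hj.
Qed.

(** Substitute each variable for itself. *)
Lemma exp_clone_equiv N M m p : exp_clone N M -> M m ->
  (forall j, exp_equiv N (expo p j) (expo m j)) -> M p.
Proof.
move=> [Mx Ms] Mm mp; have [x xE] := choice exists_variable.
apply: (Ms m x p) => // [i|j]; first exact: Mx.
suff -> : \sum_(i < arity m) expo m i * expo (x i) j = expo m j by exact: mp.
case: (ltnP j (arity m)) => jm.
  rewrite (bigD1 (Ordinal jm)) //= xE eqxx muln1 big1 ?addn0 // => i ij.
  by rewrite xE -[j]/(val (Ordinal jm)) val_eqE eq_sym (negPf ij) muln0.
rewrite expo_arity // big1 // => i _; rewrite xE gtn_eqF ?muln0 //.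
exact: leq_trans (ltn_ord i) jm.
Qed.

End ExponentVectors.

(** * Monomial clones in terms of exponents *)

Section InducedOperations.

Import GRing.Theory.
Local Open Scope classical_set_scope.
Local Open Scope nat_scope.

Variable F : finFieldType.
Local Notation N := #|F|.-1.

Lemma card_pred_gt0 : 0 < N.
Proof.
by rewrite -ltnS prednK ?finNzRing_gt1 // (leq_trans _ (finNzRing_gt1 F)).
Qed.

Lemma expf_card_pred (x : F) : x != 0%R -> (x ^+ N = 1)%R.
Proof.
move=> x0; apply: (mulfI x0); rewrite -exprS prednK ?expf_card ?mulr1 //.
exact: leq_trans (finNzRing_gt1 F).
Qed.

Lemma exists_prim_root : exists z : F, (N.-primitive_root z)%R.
Proof.
have : has (N.-primitive_root)%R [seq x <- enum F | x != 0%R].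
  apply: has_prim_root card_pred_gt0 _ _ _.
  - by apply/allP => x; rewrite mem_filter unity_rootE => /andP[/expf_card_pred->].
  - by rewrite filter_uniq // enum_uniq.
  - have -> : [seq x <- enum F | x != 0%R] = rem 0%R (enum F).
      by rewrite rem_filter ?enum_uniq.
    by rewrite size_rem ?mem_enum // -cardE.
by case/hasP => z _; exists z.
Qed.

(** A generator of the cyclic group F* detects congruence modulo its order,
    and 0 detects whether the exponent vanishes. *)
Lemma exp_equivP a b : exp_equiv N a b <-> forall x : F, (x ^+ a = x ^+ b)%R.
Proof.
split=> [[ab0 ab] x|ab].
  have [->|x0] := eqVneq x 0%R; first by rewrite !expr0n ab0.
  rewrite (divn_eq a N) (divn_eq b N) ab !exprD !(mulnC _ N) !exprM.
  by rewrite expf_card_pred ?expr1n.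
split.
  have /eqP := ab 0%R; rewrite !expr0n.
  by case: (a == 0); case: (b == 0); rewrite //= ?oner_eq0 // eq_sym oner_eq0.
have [z z_prim] := exists_prim_root.
by apply/eqP; rewrite -(eq_prim_root_expr z_prim) ab.
Qed.

(** Setting all variables but one to 1 isolates a single exponent. *)
Lemma mono_equivP m1 m2 :
  mono_equiv F m1 m2 <-> forall i, exp_equiv N (expo m1 i) (expo m2 i).
Proof.
split=> [[a12 m12] i|m12].
  case: (ltnP i (arity m1)) => im; last by rewrite !expo_arity -?a12.
  apply/exp_equivP => x.
  have ev (m : monomial) :
      induced m [tuple if j == Ordinal im then x else 1%R | j < arity m1]
      = (x ^+ expo m i)%R.
    rewrite /induced (bigD1 (Ordinal im)) //= tnth_mktuple eqxx.
    rewrite big1 ?mulr1 // => j /negPf ji.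
    by rewrite tnth_mktuple ji expr1n.
  by rewrite -ev m12 ev.
have leA (m m' : monomial) : (forall i, (expo m i == 0) = (expo m' i == 0)) ->
    arity m <= arity m'.
  by move=> e; apply/arity_leP => i im; apply/eqP; rewrite e expo_arity.
split; first by apply/eqP; rewrite eqn_leq !leA // => i; case: (m12 i).
apply/funext => x; apply: eq_bigr => i _.
by move: (tnth x i); apply/exp_equivP.
Qed.

(** Exponents multiply along composition and add along products. *)
Lemma induced_substitution n k (m p : monomial) (h : nat -> monomial)
    (x : k.-tuple F) : arity m <= n ->
  (forall j : 'I_k, exp_equiv N (expo p j)
     (\sum_(i < arity m) expo m i * expo (h i) j)) ->
  induced p x = induced m [tuple induced (h i) x | i < n].
Proof.
move=> mn pE; rewrite /induced.
under [RHS]eq_bigr do rewrite tnth_mktuple -prodrXl.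
rewrite exchange_big /=; apply: eq_bigr => j _.
have /exp_equivP -> := pE j.
rewrite -(sum_expo_widen (fun i => expo (h i) j) mn) expr_sum.
by apply: eq_bigr => i _; rewrite -exprM mulnC.
Qed.

Lemma monomial_cloneP (M : set monomial) : monomial_clone F M <-> exp_clone N M.
Proof.
split=> [[[_ Mproj Mcomp] Meq]|MC].
  split=> [i m mE|m h p Mm Mh pE].
    have [m' [Mm' am'] m'E] := Mproj i.+1 ord_max.
    apply: (Meq m') => //; apply: (@induced_inj F i.+1) => //.
      by apply/arity_leP => j ij; rewrite mE gtn_eqF.
    rewrite m'E; apply/funext => x.
    rewrite /induced (bigD1 ord_max) //= mE eqxx expr1.
    rewrite big1 ?mulr1 // => j ji.
    by rewrite mE (negPf (ji : (j != i :> nat))) expr0.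
  pose k := maxn (arity p) (\max_(i < arity m) arity (h i)).
  have hk (i : 'I_(arity m)) : arity (h i) <= k by rewrite leq_max leq_bigmax orbT.
  have [|i|p' [Mp' p'k] p'E] := Mcomp (arity m) k (@induced F _ m)
      (fun i => @induced F k (h i)).
  - by exists m.
  - by exists (h i).
  apply: (Meq p') => //; apply: (@induced_inj F k) => //; first exact: leq_maxl.
  by rewrite p'E; apply/funext => x; rewrite -(@induced_substitution _ _ m p).
split; last by move=> m1 m2 /mono_equivP m12 /(exp_clone_equiv MC); apply=> j;
  apply: exp_equiv_sym.
case: (MC) => Mx Ms; split.
- rewrite -subset0 => f [m [_ m0] _]; have [i /arity_gt] := expo_neq0 m.
  by move=> /leq_trans/(_ m0).
- move=> n i; have [x xE] := exists_variable i; exists x => //; last first.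
    apply/funext => t; rewrite /induced (bigD1 i) //= xE eqxx expr1.
    rewrite big1 ?mulr1 // => j ji.
    by rewrite xE (negPf (ji : (j != i :> nat))) expr0.
  split; first exact: Mx xE.
  by apply/arity_leP => j nj; rewrite xE gtn_eqF // (leq_trans (ltn_ord i)).
- move=> n k f g [m [Mm mn] <-{f}] Hg.
  have [x0 x0E] := exists_variable 0.
  have /choice[h hE] : forall i : nat, exists h, M h /\
      (forall lt_in : i < n, arity h <= k /\ induced h = g (Ordinal lt_in)).
    move=> i; case: (pselect (i < n)) => [lt_in|]; last first.
      by exists x0; split=> //; exact: Mx x0E.
    have [h [Mh hk] hE] := Hg (Ordinal lt_in); exists h; split=> // lt_in'.
    by rewrite (bool_irrelevance lt_in' lt_in).
  have hm (i : 'I_(arity m)) : arity (h i) <= k.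
    have [_ /(_ (leq_trans (ltn_ord i) mn))[]] := hE i; by [].
  have sum0 j : k <= j -> \sum_(i < arity m) expo m i * expo (h i) j = 0.
    move=> kj; apply: substitution_eq0; apply: leq_trans kj.
    by apply/bigmax_leqP => i _.
  have [p pE] := exists_monomial sum0 (substitution_neq0 m h).
  exists p.
    split; first by apply: (Ms m h) => // [i|j]; [case: (hE i)|rewrite pE].
    by apply/arity_leP => j kj; rewrite pE sum0.
  apply/funext => x; rewrite (@induced_substitution n k m p h) //; last first.
    by move=> j; rewrite pE.
  congr induced; apply: eq_mktuple => -[i lt_in] /=.
  by have [_ /(_ lt_in)[_ ->]] := hE i.
Qed.

Lemma generated_smallest (X : set monomial) :
  generated F X = smallest (exp_clone N) X.
Proof.
by congr smallest; apply/funext => M; apply/propext; exact: monomial_cloneP.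
Qed.

End InducedOperations.

(** * The candidate coatoms and their generators *)

Section Families.

Local Open Scope classical_set_scope.
Local Open Scope nat_scope.

(** Membership stated on the exponents, so that vectors can be written as plain
    functions. It is false for the zero vector, which is not a monomial. *)
Definition mem_expo (M : set monomial) (a : nat -> nat) : Prop :=
  exists2 m, M m & expo m =1 a.

Lemma mem_expoP (M : set monomial) m : mem_expo M (expo m) <-> M m.
Proof. by split=> [[m' Mm' /monomial_eqP <-] //|Mm]; exists m. Qed.

Lemma mem_expo_ext M a b : a =1 b -> mem_expo M a -> mem_expo M b.
Proof. by move=> ab [m Mm mE]; exists m => // i; rewrite mE ab. Qed.

Lemma mono_mem_expo M a : has (fun e => e != 0) a ->
  mono a `<=` M -> mem_expo M (nth 0 a).
Proof.
move=> /mono_singleton[m mE] aM.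
have am : mono a m by rewrite mE.
by exists m; [exact: (aM m am)|exact: am].
Qed.

Section Substitution.

Variables (N : nat) (M : set monomial).
Hypothesis MC : exp_clone N M.

Lemma mem_variable i : mem_expo M (fun j => (j == i) : nat).
Proof. by have [x xE] := exists_variable i; exists x => //; apply: MC.1 xE. Qed.

Lemma mem_equiv a b : mem_expo M a ->
  (forall j, exp_equiv N (b j) (a j)) -> mem_expo M b.
Proof.
move=> [m Mm mE] ba; have [i mi] := expo_neq0 m.
have [|| p pE] := @exists_monomial b (arity m).
- by move=> j mj; apply/eqP; rewrite (ba j).1 -mE expo_arity.
- by exists i; rewrite (ba i).1 -mE.
by exists p => //; apply: (exp_clone_equiv MC Mm) => j; rewrite pE mE.
Qed.

(** The working form of closure under substitution: the vectors are functions,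
    and the result is only required up to equivalence. Its finite support and
    its being nonzero follow from that equivalence. *)
Lemma mem_substitution a n (h : nat -> nat -> nat) b : mem_expo M a ->
  (forall i, n <= i -> a i = 0) -> (forall i, i < n -> mem_expo M (h i)) ->
  (forall j, exp_equiv N (b j) (\sum_(i < n) a i * h i j)) -> mem_expo M b.
Proof.
move=> [m Mm mE] an Mh bE.
have mn : arity m <= n by apply/arity_leP => i; rewrite mE; exact: an.
have /choice[H HE] : forall i, exists x, M x /\ (i < n -> expo x =1 h i).
  move=> i; case: (ltnP i n) => [/Mh[x Mx xE]|_]; first by exists x.
  by have [x Mx _] := mem_variable i; exists x.
have hE j : \sum_(i < n) a i * h i j = \sum_(i < arity m) expo m i * expo (H i) j.
  rewrite -(sum_expo_widen (fun i => expo (H i) j) mn).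
  by apply: eq_bigr => i _; rewrite mE (HE i).2.
have [p pE] := exists_monomial (@substitution_eq0 m H) (substitution_neq0 m H).
apply: (@mem_equiv (expo p)) => [|j]; last by rewrite pE -hE.
exists p => //; apply: (MC.2 m H) => // [i|j]; first exact: (HE i).1.
by rewrite pE.
Qed.

End Substitution.

Lemma smallest_exp_clone N X K : exp_clone N K -> X `<=` K ->
  (forall M, exp_clone N M -> X `<=` M -> K `<=` M) ->
  smallest (exp_clone N) X = K.
Proof.
move=> KC XK Kmin; apply/seteqP; split; first exact: smallest_sub.
by move=> m Km M [MC XM]; exact: Kmin Km.
Qed.

Lemma eq_mod_sum d (I : finType) (f g : I -> nat) :
  (forall i, f i = g i %[mod d]) -> \sum_i f i = \sum_i g i %[mod d].
Proof.
move=> fg; apply: (big_ind2 (fun a b => a = b %[mod d])) => //.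
by move=> a b a' b' ab ab'; rewrite -modnDm ab ab' modnDm.
Qed.

Lemma exp_equiv_mod N d a b : d %| N -> exp_equiv N a b -> a = b %[mod d].
Proof. by move=> dN [_ ab]; rewrite -(modn_dvdm a dN) ab modn_dvdm. Qed.

Lemma exp_equiv_dvd N d a b : d %| N -> exp_equiv N a b -> (d %| a) = (d %| b).
Proof. by move=> dN /(exp_equiv_mod dN) ab; rewrite /dvdn ab. Qed.

(** A monomial as the multiset of its variables: this allows induction on the
    degree, and exponents arise by substituting the same variable repeatedly. *)
Lemma multiset_of_expo (a : nat -> nat) n : exists s : seq nat,
  size s = \sum_(i < n) a i /\
  forall j, count_mem j s = if j < n then a j else 0.
Proof.
elim: n => [|n [s [s_size sE]]]; first by exists [::]; rewrite big_ord0.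
exists (nseq (a n) n ++ s); split=> [|j].
  by rewrite size_cat size_nseq s_size big_ord_recr /= addnC.
rewrite count_cat count_nseq sE (ltnS j n) (leq_eqVlt j n) /= (eq_sym n j).
by have [->|_] := eqVneq j n; rewrite ?ltnn /= ?mul1n ?addn0 ?mul0n.
Qed.

Definition total_degree (m : monomial) := \sum_(i < arity m) expo m i.

Lemma total_widen m n : arity m <= n -> \sum_(i < n) expo m i = total_degree m.
Proof.
move=> mn; have := sum_expo_widen (fun=> 1) mn.
by under eq_bigr do rewrite muln1; under [RHS]eq_bigr do rewrite muln1.
Qed.

Lemma multiset_of_monomial m : exists s : seq nat,
  size s = total_degree m /\ forall j, expo m j = count_mem j s.
Proof.
have [s [s_size sE]] := multiset_of_expo (expo m) (arity m).
by exists s; split=> // j; rewrite sE; case: ltnP => // /expo_arity.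
Qed.

Lemma total_gt0 m : 0 < total_degree m.
Proof.
have [i mi] := expo_neq0 m.
by rewrite /total_degree (bigD1 (Ordinal (arity_gt mi))) //= addn_gt0 lt0n mi.
Qed.

Definition total_clone (d : nat) : set monomial :=
  [set m | total_degree m = 1 %[mod d]].

(** Under substitution the total degree is a combination of the total degrees of
    the arguments, all equal to 1 modulo d, so it is that of m modulo d. The
    condition d %| N makes the residue invariant under equivalence. *)
Lemma total_cloneP N d : d %| N -> exp_clone N (total_clone d).
Proof.
move=> dN; split=> [i m mE|m h p mK hK pE].
  have mi : arity m <= i.+1 by apply/arity_leP => j ij; rewrite mE gtn_eqF.
  rewrite /total_clone /= -(total_widen mi) (bigD1 ord_max) //= mE eqxx.
  by rewrite big1 // => j ji; rewrite mE (negPf (ji : (j != i :> nat))).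
pose k := \max_(i < arity m) arity (h i).
have pk : arity p <= k.
  by apply/arity_leP => j kj; apply/eqP; rewrite (pE j).1 substitution_eq0.
rewrite /total_clone /= -(total_widen pk).
rewrite (eq_mod_sum (fun j : 'I_k => exp_equiv_mod dN (pE j))) exchange_big /=.
under eq_bigr => i _ do rewrite -big_distrr /= total_widen ?leq_bigmax //.
rewrite -mK; apply: eq_mod_sum => i.
by rewrite -modnMmr (hK i) modnMmr muln1.
Qed.

(** Putting a monomial of degree 1 + k d in the last variable of
    x_1 ... x_(1+d) and variables in the others reaches every monomial of degree
    1 + (k + 1) d. *)
Lemma mem_count_mem N M d s k : exp_clone N M ->
  mem_expo M (nth 0 (nseq (1 + d) 1)) -> size s = 1 + k * d ->
  mem_expo M (fun j => count_mem j s).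
Proof.
move=> MC Md; elim: k s => [|k IHk] s.
  case: s => [|i [|]] //= _; apply: mem_expo_ext (mem_variable MC i) => j /=.
  by rewrite addn0 eq_sym.
rewrite mulSn addnCA => s_size.
pose h i := if i < d then fun j => (j == nth 0 s i) : nat
            else fun j => count_mem j (drop d s).
apply: (mem_substitution MC (n := 1 + d) (h := h) Md).
- by move=> i di; rewrite nth_default // size_nseq.
- move=> i _; rewrite /h; case: ifP => _; first exact: (mem_variable MC).
  by apply: IHk; rewrite size_drop s_size addKn.
move=> j; rewrite (eq_bigr (fun i : 'I_(1 + d) => h i j)); last first.
  by move=> i _; rewrite nth_nseq ltn_ord mul1n.
rewrite big_ord_recr /= {2}/h ltnn -{1}(cat_take_drop d s) count_cat.
rewrite (eq_bigr (fun i : 'I_d => (j == nth 0 s i) : nat)); last first.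
  by move=> i _; rewrite /h /= ltn_ord.
suff -> : count_mem j (take d s) = \sum_(i < d) (j == nth 0 s i) by [].
rewrite -sum1_count (big_nth 0) big_mkord size_takel ?s_size ?leq_addr //.
rewrite [LHS]big_mkcond; apply: eq_bigr => i _; rewrite /= nth_take // eq_sym.
by case: eqP.
Qed.

Lemma total_clone_generated N d : 0 < d -> d %| N ->
  smallest (exp_clone N) (mono (nseq (1 + d) 1)) = total_clone d.
Proof.
move=> d0 dN; apply: smallest_exp_clone; first exact: total_cloneP.
  move=> m mE; have md : arity m <= 1 + d.
    by apply/arity_leP => i di; rewrite mE nth_default // size_nseq.
  rewrite /total_clone /= -(total_widen md).
  rewrite (eq_bigr (fun=> 1)) => [|i _]; last by rewrite mE nth_nseq ltn_ord.
  by rewrite sum1_card card_ord modnDr.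
move=> M MC dM m mK; have [s [s_size mE]] := multiset_of_monomial m.
apply/mem_expoP; apply: (@mem_expo_ext _ (fun j => count_mem j s)) => //.
apply: (@mem_count_mem N M d s ((total_degree m).-1 %/ d)) => //.
  exact: mono_mem_expo.
have dt : d %| (total_degree m).-1.
  by rewrite -subn1 -eqn_mod_dvd ?total_gt0 //; apply/eqP.
by rewrite divnK // s_size add1n prednK // total_gt0.
Qed.

Lemma total_clone1 : total_clone 1 = setT.
Proof. by apply/seteqP; split=> // m _; rewrite /total_clone /= !modn1. Qed.

Lemma dvd_prime_prod (I : finType) (A : {set I}) (f : I -> nat) p : prime p ->
  p %| \prod_(i in A) f i -> exists2 i, i \in A & p %| f i.
Proof.
move=> p_pr; rewrite Euclid_dvd_prod // big_has_cond => /hasP[i _ /andP[iA pf]].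
by exists i.
Qed.

Lemma dvdn_prod_primes (I : finType) (A : {set I}) (f : I -> nat) a :
  (forall i, i \in A -> prime (f i)) -> {in A &, injective f} ->
  (forall i, i \in A -> f i %| a) -> \prod_(i in A) f i %| a.
Proof.
have [n] := ubnP #|A|; elim: n A => // n IHn A /ltnSE An f_pr f_inj fa.
have [->|[i iA]] := set_0Vmem A; first by rewrite big_set0.
rewrite (big_setD1 i) //= Gauss_dvd ?fa //=.
  apply: IHn => [|j||j]; rewrite ?inE.
  - by apply: leq_trans An; rewrite (cardsD1 i A) iA.
  - by case/andP=> _; apply: f_pr.
  - by move=> j k; rewrite !inE => /andP[_ jA] /andP[_ kA]; apply: f_inj.
  - by case/andP=> _; apply: fa.
rewrite prime_coprime ?f_pr //; apply/negP.
case/dvd_prime_prod => [|j]; first exact: f_pr.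
rewrite !inE => /andP[ji jA]; rewrite dvdn_prime2 ?f_pr // => /eqP/f_inj ij.
by rewrite ij ?eqxx in ji.
Qed.

Section NearMultiples.

Variables (I : finType) (P : I -> nat) (D : {set I}).

Definition multiple_clone : set monomial :=
  [set m | (exists2 i, i \in D & forall j, P i %| expo m j) \/
           (exists j, forall k, k != j -> forall i, i \in D -> P i %| expo m k)].

(** If m is divisible by every P i outside the variable v, only the monomial h v
    put in v matters modulo the P i, and the composite inherits the shape of
    h v. *)
Lemma multiple_cloneP N :
  (forall i, i \in D -> P i %| N) -> exp_clone N multiple_clone.
Proof.
move=> PN; split=> [i m mE|m h p mW hW pE].
  by right; exists i => j ji k kD; rewrite mE (negPf ji).
have dvd_p i j : i \in D ->
    (P i %| expo p j) = (P i %| \sum_(v < arity m) expo m v * expo (h v) j).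
  by move=> iD; apply: exp_equiv_dvd (PN i iD) (pE j).
case: mW => [[i iD mi]|[v mv]].
  left; exists i => // j; rewrite dvd_p //.
  by apply: dvdn_sum => v _; rewrite dvdn_mulr.
have dvd_hv i j : i \in D -> P i %| expo (h v) j -> P i %| expo p j.
  move=> iD hv; rewrite dvd_p //; apply: dvdn_sum => w _.
  have [->|wv] := eqVneq (w : nat) v; first exact: dvdn_mull.
  by rewrite dvdn_mulr // mv.
case: (hW v) => [[i iD hv]|[j hv]]; [left|right].
  by exists i => // j; apply: dvd_hv.
by exists j => k kj i iD; apply: dvd_hv => //; apply: hv.
Qed.

(** Grouped as in [Sclone], so that [generated F multiple_gens] is [Sclone F P D]
    by conversion. *)
Definition multiple_gens : set monomial :=
  [set m | exists2 t, 0 < t & mono [:: t] m] `|`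
  [set m | exists n i, [/\ 0 < n, i \in D & mono (nseq n (P i)) m]] `|`
  mono [:: 1; \prod_(i in D) P i].

(** A monomial with all exponents divisible by P i comes from
    (x_1 ... x_n)^(P i) by putting variables, with repetitions. One of the other
    shape is x_v^t times T-th powers of variables. If t > 0, start with x_v^t and
    substitute in x_1 x_2^T, for x_1 what is already built and for x_2 one more
    variable. If t = 0, the monomial has the first shape too, D being nonempty. *)
Lemma multiple_clone_generated N : D != finset.set0 ->
  (forall i, i \in D -> prime (P i)) -> injective P ->
  (forall i, i \in D -> P i %| N) ->
  smallest (exp_clone N) multiple_gens = multiple_clone.
Proof.
move=> /set0Pn[i0 i0D] Pp Pinj PN; set T := \prod_(i in D) P i.
have dvd_T i : i \in D -> P i %| T by move=> iD; rewrite /T (bigD1 i) //= dvdn_mulr.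
apply: smallest_exp_clone; first exact: multiple_cloneP.
  move=> m [[[t t0 mE]|[n [i [n0 iD mE]]]]|mE].
  - by right; exists 0 => -[|[|k]] // _ i iD; rewrite mE.
  - left; exists i => // j; rewrite mE nth_nseq.
    by case: ifP.
  - right; exists 0 => -[|[|k]] // _ i iD; rewrite mE //=; first exact: dvd_T.
    by rewrite nth_nil.
move=> M MC XM.
have Munary t v : 0 < t -> mem_expo M (fun j => t * (j == v)).
  move=> t0.
  have Mt : mem_expo M (nth 0 [:: t]).
    apply: mono_mem_expo; first by rewrite /= -lt0n t0.
    by move=> m mE; apply: XM; left; left; exists t.
  apply: (mem_substitution MC (n := 1) (h := fun=> fun j => (j == v) : nat) Mt).
  - by move=> -[|[|]].
  - by move=> i _; exact: (mem_variable MC).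
  - by move=> j; rewrite big_ord1.
have Mmult i s : i \in D -> s != [::] -> mem_expo M (fun j => P i * count_mem j s).
  move=> iD s0.
  have Mi : mem_expo M (nth 0 (nseq (size s) (P i))).
    apply: mono_mem_expo.
      by rewrite has_nseq lt0n size_eq0 s0 -lt0n prime_gt0 ?Pp.
    move=> m mE; apply: XM; left; right; exists (size s), i.
    by split; rewrite // lt0n size_eq0.
  apply: (mem_substitution MC (n := size s)
            (h := fun k => fun j => (j == nth 0 s k) : nat) Mi).
  - by move=> k sk; rewrite nth_default // size_nseq.
  - by move=> k _; exact: (mem_variable MC).
  - move=> j; rewrite -sum1_count (big_nth 0) big_mkord big_mkcond big_distrr /=.
    rewrite (eq_bigr (fun k : 'I_(size s) =>
      nth 0 (nseq (size s) (P i)) k * (j == nth 0 s k))) // => k _.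
    by rewrite nth_nseq ltn_ord eq_sym; case: eqP.
have Mnear t v s : 0 < t -> mem_expo M (fun j => t * (j == v) + T * count_mem j s).
  move=> t0; elim: s => [|i s IHs].
    by apply: mem_expo_ext (Munary t v t0) => j; rewrite muln0 addn0.
  have MT : mem_expo M (nth 0 [:: 1; T]).
    by apply: mono_mem_expo => // m mE; apply: XM; right.
  apply: (mem_substitution MC (n := 2) (h := fun k => if k is 0 then
            fun j => t * (j == v) + T * count_mem j s else
            fun j => (j == i) : nat) MT).
  - by move=> -[|[|[|]]].
  - by move=> -[|k] _ //; exact: (mem_variable MC).
  - move=> j; rewrite !big_ord_recl big_ord0 /= mul1n addn0 -addnA -mulnDr.
    by rewrite (eq_sym j i) (addnC (count _ _)).
have Tdvd a : (forall i, i \in D -> P i %| a) -> T %| a.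
  by move=> Da; apply: dvdn_prod_primes => //; apply: in2W.
move=> m mW; apply/mem_expoP.
have quot d : (forall j, d %| expo m j) -> exists2 s, s != [::] &
    forall j, expo m j = d * count_mem j s.
  move=> dm; have [s [_ sE]] := multiset_of_expo (fun j => expo m j %/ d) (arity m).
  have mE j : expo m j = d * count_mem j s.
    rewrite sE; case: ltnP => [_|/expo_arity ->]; last by rewrite muln0.
    by rewrite mulnC divnK.
  exists s => //; apply/eqP => s0; have [j] := expo_neq0 m.
  by rewrite mE s0 muln0.
case: mW => [[i iD /quot[s s0 mE]]|[v mv]].
  by apply: mem_expo_ext (Mmult i s iD s0) => j; rewrite mE.
have [mv0|mv_gt0] := posnP (expo m v).
  have [|s s0 mE] := quot (P i0); last by
    apply: mem_expo_ext (Mmult i0 s i0D s0) => j; rewrite mE.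
  by move=> j; have [->|jv] := eqVneq j v; rewrite ?mv0 // mv.
have [s [_ sE]] := multiset_of_expo
  (fun j => if j == v then 0 else expo m j %/ T) (arity m).
apply: mem_expo_ext (Mnear _ v s mv_gt0) => j; rewrite sE.
have [->|jv] := eqVneq j v; first by rewrite muln1 if_same muln0 addn0.
rewrite muln0 add0n; case: ltnP => [_|/expo_arity->]; last by rewrite muln0.
by rewrite mulnC divnK // Tdvd // => i; apply: mv.
Qed.

End NearMultiples.

End Families.

(** * Clones contained in no candidate contain all monomials *)

Section ProperClones.

Import GRing.Theory.
Local Open Scope classical_set_scope.
Local Open Scope nat_scope.

(** An affine map that preserves the finite set G permutes it. *)
Lemma affine_sum (K : finFieldType) (G : {set K}) (a r : K) : (a != 0)%R ->
  (forall g, g \in G -> (a * g + r)%R \in G) ->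
  (\sum_(g in G) g = a * (\sum_(g in G) g) + r *+ #|G|)%R.
Proof.
move=> a0 aG; pose f g := (a * g + r)%R.
have f_inj : injective f by move=> g g' /addIr /(mulfI a0).
have fG : f @: G = G.
  apply/eqP; rewrite eqEcard card_imset // leqnn andbT.
  by apply/fintype.subsetP => _ /imsetP[g gG ->]; exact: aG.
rewrite -{1}fG big_imset /=; last by move=> g g' _ _; exact: f_inj.
by rewrite /f big_split /= sumr_const mulr_sumr.
Qed.

Lemma eqFp p (p_pr : prime p) a b :
  (a%:R == b%:R :> 'F_p)%R = (a == b %[mod p]).
Proof.
apply/eqP/eqP => [/(congr1 val)|ab].
  by rewrite /= !val_Fp_nat.
by apply: val_inj; rewrite /= !val_Fp_nat.
Qed.

Lemma eqFp0 p (p_pr : prime p) a : (a%:R == 0 :> 'F_p)%R = (p %| a).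
Proof. by rewrite -(mulr0n 1%R) eqFp // mod0n. Qed.

Lemma dvdn_eqmod0 d a : d %| a -> a = 0 %[mod d].
Proof. by move=> /eqP ->; rewrite mod0n. Qed.

(** The exponent N! is a multiple of p - 1 for all primes p <= N at once. *)
Lemma fermat_fact N p a : prime p -> p <= N -> ~~ (p %| a) -> a ^ N`! = 1 %[mod p].
Proof.
move=> p_pr pN pa.
have /dvdnP[k ->] : p.-1 %| N`!.
  by rewrite dvdn_fact // -subn1 subn_gt0 prime_gt1 //= (leq_trans (leq_subr _ _)).
rewrite mulnC expnM -modnXm -(totient_prime p_pr) Euler_exp_totient.
  by rewrite modnXm exp1n.
by rewrite coprime_sym prime_coprime.
Qed.

Variables (N : nat) (M : set monomial).
Hypothesis N_gt0 : 0 < N.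
Hypothesis MC : exp_clone N M.

Definition mem_power t := mem_expo M (nth 0 [:: t]).

Lemma mem_power_gt0 t : mem_power t -> 0 < t.
Proof.
by case=> m _ mE; have [[|i]] := expo_neq0 m; rewrite mE ?lt0n //= nth_nil.
Qed.

Lemma mem_scale a t : mem_expo M a -> mem_power t -> mem_expo M (fun j => t * a j).
Proof.
move=> Ma Mt; apply: (mem_substitution MC (n := 1) (h := fun=> a) Mt) => //.
  by move=> [|[|]].
by move=> j; rewrite big_ord1.
Qed.

Lemma mem_power_equiv s t : mem_power s -> exp_equiv N t s -> mem_power t.
Proof. by move=> Ms ts; apply: (mem_equiv MC Ms) => -[|[|]]. Qed.

Lemma mem_power1 : mem_power 1.
Proof. by apply: mem_expo_ext (mem_variable MC 0) => -[|[|]]. Qed.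

Lemma mem_power_mul s t : mem_power s -> mem_power t -> mem_power (s * t).
Proof.
move=> Ms Mt; apply: mem_expo_ext (mem_scale Mt Ms) => -[|j] //=.
by rewrite nth_nil muln0.
Qed.

Lemma mem_power_exp s k : mem_power s -> mem_power (s ^ k).
Proof.
move=> Ms; elim: k => [|k IHk]; first exact: mem_power1.
by rewrite expnS; exact: mem_power_mul.
Qed.

Lemma mem_power_prod (I : finType) (A : {pred I}) (s : I -> nat) :
  (forall i, i \in A -> mem_power (s i)) -> mem_power (\prod_(i in A) s i).
Proof.
move=> Ms; apply: (big_ind mem_power) => //; first exact: mem_power1.
exact: mem_power_mul.
Qed.

Lemma mem_power_variable t v : mem_power t -> mem_expo M (fun j => t * (j == v)).
Proof. by move=> Mt; exact: (mem_scale (mem_variable MC v)). Qed.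

Lemma mem_power_sum m (t : nat -> nat) : M m -> (forall v, mem_power (t v)) ->
  mem_power (\sum_(v < arity m) expo m v * t v).
Proof.
move=> Mm Mt; apply: (mem_substitution MC (a := expo m) (n := arity m)
  (h := fun v => nth 0 [:: t v])).
- by apply/mem_expoP.
- exact: expo_arity.
- by move=> v _; apply: Mt.
- move=> [|j] /=; first exact: exp_equiv_refl.
  rewrite nth_nil big1 // => v _.
  by rewrite ?nth_nil muln0.
Qed.

Lemma total_power m : M m -> mem_power (total_degree m).
Proof.
move=> Mm; have := mem_power_sum Mm (fun=> mem_power1).
by under eq_bigr do rewrite muln1.
Qed.

Lemma sum_two_coordinates m j k (t : nat -> nat) : expo m j != 0 ->
  expo m k != 0 -> k != j ->
  \sum_(w < arity m) expo m w * t w = expo m j * t j + (expo m k * t k +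
    \sum_(w < arity m | (w != j :> nat) && (w != k :> nat)) expo m w * t w).
Proof.
move=> /arity_gt jm /arity_gt km kj.
by rewrite (bigD1 (Ordinal jm)) //= (bigD1 (Ordinal km)).
Qed.

(** If the powers in M are prime to p, and not all 1 modulo p, then each monomial
    of M has at most one exponent prime to p. Let G be the set of residues of these
    powers. Given exponents a, b prime to p, put x^s and x^t in their variables
    and x elsewhere: a s + (b t + c) is again in G. Hence
    sum G = a (sum G) + (b t + c) #|G| for all t in G, which forces b t to be
    constant because #|G|, lying strictly between 0 and p, is invertible. *)
Lemma unit_powers_concentrated p : prime p ->
  (forall t, mem_power t -> ~~ (p %| t)) ->
  (exists2 t, mem_power t & t != 1 %[mod p]) ->
  forall m, M m -> exists j, forall k, k != j -> p %| expo m k.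
Proof.
move=> p_pr Munit [t0 Mt0 t01] m Mm.
pose G := [set x : 'F_p | `[< exists2 t, mem_power t & x = (t%:R)%R >]]%SET.
have GP (x : 'F_p) : reflect (exists2 t, mem_power t & x = (t%:R)%R) (x \in G).
  by rewrite inE; exact: asboolP.
have cardG : (#|G|%:R != 0 :> 'F_p)%R.
  rewrite eqFp0 // gtnNdvd //.
    by apply/card_gt0P; exists 1%R; apply/GP; exists 1 => //; exact: mem_power1.
  rewrite -[X in _ < X](card_Fp p_pr) -cardsT proper_card // properT.
  apply/negP => /eqP GT; have /GP[t /Munit] : (0 : 'F_p)%R \in G by rewrite GT inE.
  by rewrite -eqFp0 // => /eqP t0' t0''; rewrite -t0'' in t0'.
have two j k : k != j -> ~~ (p %| expo m j) -> ~~ (p %| expo m k) -> False.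
  move=> kj pj pk.
  have mj : expo m j != 0 by apply: contraNneq pj => ->; rewrite dvdn0.
  have mk : expo m k != 0 by apply: contraNneq pk => ->; rewrite dvdn0.
  pose c := \sum_(w < arity m | (w != j :> nat) && (w != k :> nat)) expo m w.
  have sumG t : mem_power t ->
      (\sum_(g in G) g = (expo m j)%:R * (\sum_(g in G) g) +
      ((expo m k)%:R * t%:R + c%:R) *+ #|G| :> 'F_p)%R.
    move=> Mt; apply: affine_sum; first by rewrite eqFp0.
    move=> _ /GP[s Ms ->]; apply/GP.
    pose tau w := if w == j then s else if w == k then t else 1.
    exists (\sum_(w < arity m) expo m w * tau w).
      apply: mem_power_sum => // w; rewrite /tau.
      by case: ifP => // _; case: ifP => // _; exact: mem_power1.
    rewrite (sum_two_coordinates tau mj mk kj) /tau eqxx (negPf kj) eqxx.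
    rewrite (eq_bigr (fun w : 'I_(arity m) => expo m w)); last first.
      by move=> w /andP[/negPf-> /negPf->]; rewrite muln1.
    by rewrite -/c !natrD !natrM.
  have := sumG _ Mt0; rewrite {1}(sumG _ mem_power1) => /addrI.
  rewrite -[LHS]mulr_natr -[RHS]mulr_natr => /(mulIf cardG) /addIr.
  have /mulfI akI : ((expo m k)%:R != 0 :> 'F_p)%R by rewrite eqFp0.
  move=> /akI /eqP; rewrite eqFp // eq_sym.
  by rewrite (negPf t01).
have [[j pj]|pm] := pselect (exists j, ~~ (p %| expo m j)).
  exists j => k kj; apply/negPn/negP; exact: two kj pj.
exists 0 => k _; apply/negPn/negP => pk; apply: pm; by exists k.
Qed.

Section Completeness.

Hypothesis N_gt1 : 1 < N.
Variables (I : finType) (P : I -> nat).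
Hypothesis P_pr : forall i, prime (P i).
Hypothesis P_dvd : forall i, P i %| N.
Hypothesis P_all : forall p, prime p -> p %| N -> exists i, P i = p.

Hypothesis M_total : forall i, ~ (M `<=` total_clone (P i)).
Hypothesis M_multiple :
  forall D : {set I}, D != finset.set0 -> ~ (M `<=` multiple_clone P D).

Lemma not_multiple (D : {set I}) : D != finset.set0 -> exists m, [/\ M m,
  forall i, i \in D -> exists j, ~~ (P i %| expo m j)
  & forall j, exists k i, [/\ k != j, i \in D & ~~ (P i %| expo m k)]].
Proof.
move=> /M_multiple /nonsubset[m [Mm /not_orP[m1 m2]]]; exists m.
split=> // [i iD|j].
  apply: contrapT => mi; apply: m1; exists i => // j.
  by apply/negPn/negP => ij; apply: mi; exists j.
apply: contrapT => mj; apply: m2; exists j => k kj i iD.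
by apply/negPn/negP => ik; apply: mj; exists k, i.
Qed.

(** Otherwise the powers in M are prime to P i, and M would lie below the clone
    attached to {P i}. *)
Lemma exists_multiple_power i : exists2 t, mem_power t & P i %| t.
Proof.
apply: contrapT => Mi.
have [|m [Mm _ mP]] := @not_multiple (finset.set1 i).
  by apply/set0Pn; exists i; rewrite inE.
have [||||j mj] := @unit_powers_concentrated (P i) _ _ _ m => //.
- by move=> t Mt; apply/negP => it; apply: Mi; exists t.
- have /nonsubset[m' [Mm' m'1]] := @M_total i.
  by exists (total_degree m'); [exact: total_power|exact/eqP].
have [k [i' [kj]]] := mP j.
by rewrite inE => /eqP ->; rewrite mj.
Qed.

(** Multiplying powers provided by [exists_multiple_power] gives a power divisible
    by all primes of N; its N-th power is divisible by N. *)
Lemma mem_powerN : mem_power N.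
Proof.
have /fin_all_exists[t /all_and2[Mt tP]] :
    forall i, exists t, mem_power t /\ P i %| t.
  by move=> i; have [t Mt it] := exists_multiple_power i; exists t.
pose s := \prod_i t i.
have Ms : mem_power (s ^ N) by apply/mem_power_exp/mem_power_prod => i _.
apply: (mem_power_equiv Ms); apply: exp_equiv_pos => //.
  exact: mem_power_gt0 Ms.
rewrite modnn; apply/esym/eqP/dvdn_partP => // p.
rewrite mem_primes => /and3P[p_pr _ /(P_all p_pr)[i <-]].
rewrite p_part; apply: dvdn_trans (dvdn_exp2r N _).
  by apply: dvdn_exp2l; rewrite ltnW // ltn_logl.
by rewrite /s (bigD1 i) //= dvdn_mulr.
Qed.

(** Put x_1 in the variable v and x_1^N, which is neutral modulo N, in the
    others. *)
Lemma coordinate_power m v : M m ->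
  exists2 s, mem_power s & s = expo m v %[mod N].
Proof.
move=> Mm; pose t w := if w == v then 1 else N.
exists (\sum_(w < arity m) expo m w * t w).
  apply: mem_power_sum => // w; rewrite /t.
  by case: ifP => _; [exact: mem_power1|exact: mem_powerN].
have others (A : pred 'I_(arity m)) : (forall w, A w -> w != v :> nat) ->
    \sum_(w < arity m | A w) expo m w * t w = 0 %[mod N].
  move=> Av; apply/eqP; rewrite mod0n; apply: dvdn_sum => w /Av/negPf wv.
  by rewrite /t wv dvdn_mull.
case: (ltnP v (arity m)) => vm; last first.
  rewrite [in RHS]expo_arity // others // => w _; rewrite neq_ltn.
  by rewrite (leq_trans (ltn_ord w) vm).
rewrite (bigD1 (Ordinal vm)) //= {1}/t eqxx muln1 -modnDmr others.
  by rewrite mod0n addn0.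
by move=> w.
Qed.

Definition mem_pair c := mem_expo M (nth 0 [:: c; c]).

Lemma mem_pair_gt0 c : mem_pair c -> 0 < c.
Proof.
by case=> m _ mE; have [[|[|i]]] := expo_neq0 m; rewrite mE ?lt0n //= nth_nil.
Qed.

Lemma mem_pair_scale c t : mem_pair c -> mem_power t -> mem_pair (t * c).
Proof.
move=> Mc Mt; apply: mem_expo_ext (mem_scale Mc Mt) => -[|[|j]] //=.
by rewrite nth_nil muln0.
Qed.

Lemma mem_pair_power c : mem_pair c -> mem_power c.
Proof.
move=> Mc; have c0 := mem_pair_gt0 Mc.
apply: (mem_substitution MC (n := 2)
  (h := fun v => nth 0 [:: if v is 0 then 1 else N]) Mc).
- by move=> [|[|[|]]].
- by move=> [|v] _; [exact: mem_power1|exact: mem_powerN].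
- move=> [|j]; rewrite !big_ord_recl big_ord0 /= ?nth_nil ?muln0 //.
  apply: exp_equiv_pos => //; first by rewrite muln1 addn_gt0 c0.
  by rewrite muln1 addn0 -modnDmr modnMl addn0.
Qed.

Lemma mem_pair_exp c k : mem_pair c -> 0 < k -> mem_pair (c ^ k).
Proof.
move=> Mc; case: k => // k _; rewrite expnSr; apply: mem_pair_scale => //.
exact/mem_power_exp/mem_pair_power.
Qed.

Lemma mem_pair_sum m (e : nat -> nat) : M m -> (forall v, mem_pair (e v)) ->
  mem_pair (\sum_(v < arity m) expo m v * e v).
Proof.
move=> Mm Me; apply: (mem_substitution MC (a := expo m) (n := arity m)
  (h := fun v => nth 0 [:: e v; e v])).
- by apply/mem_expoP.
- exact: expo_arity.
- by move=> v _; apply: Me.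
- move=> [|[|j]] /=; try exact: exp_equiv_refl.
  rewrite nth_nil big1 // => v _.
  by rewrite ?nth_nil muln0.
Qed.

(** Keep two variables of m, and raise each to the exponent of the other to make
    both exponents equal. *)
Lemma mem_pair_coordinates m j k : M m ->
  k != j -> expo m j != 0 -> expo m k != 0 ->
  exists2 c, mem_pair c & c = expo m j * expo m k %[mod N].
Proof.
move=> Mm kj mj mk.
have [s Ms sj] := coordinate_power j Mm; have [r Mr rk] := coordinate_power k Mm.
have s0 := mem_power_gt0 Ms; have r0 := mem_power_gt0 Mr.
exists (s * r); last by rewrite -modnMm sj rk modnMm.
pose t w := if w == j then r else if w == k then s else N.
have jk : j != k by rewrite eq_sym.
apply: (mem_substitution MC (a := expo m) (n := arity m)
  (h := fun w i => t w * (i == (w == k) :> nat))).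
- by apply/mem_expoP.
- exact: expo_arity.
- move=> w _; apply: mem_power_variable; rewrite /t.
  by case: ifP => // _; case: ifP => // _; exact: mem_powerN.
- move=> i.
  rewrite (sum_two_coordinates (fun w => t w * (i == (w == k) :> nat)) mj mk kj).
  rewrite /t !eqxx (negPf jk) (negPf kj).
  case: i => [|[|i]] /=.
  + apply: exp_equiv_pos; first by rewrite muln_gt0 s0.
      by rewrite muln1 addn_gt0 muln_gt0 lt0n mj r0.
    rewrite -modnMml sj modnMml muln1 -modnDmr.
    suff -> : expo m k * (s * 0) +
      \sum_(w < arity m | (w != j :> nat) && (w != k :> nat))
      expo m w * ((if w == j :> nat then r else if w == k :> nat then s else N) *
        (0 == (w == k :> nat) :> nat)) = 0 %[mod N] by rewrite mod0n addn0.
    apply/eqP; rewrite !muln0 mod0n; apply: dvdn_sum => w /andP[/negPf-> /negPf->].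
    by rewrite dvdn_mull // dvdn_mulr.
  + rewrite muln0 muln0 add0n big1 ?addn0 ?muln1; last first.
      by move=> w /andP[_ /negPf->]; rewrite !muln0.
    apply: exp_equiv_pos; rewrite ?muln_gt0 ?s0 ?lt0n ?mk // -?lt0n //.
    by rewrite mulnC -modnMml rk modnMml.
  + rewrite nth_nil !muln0 big1 // => w /andP[_ /negPf->].
    by rewrite !muln0.
Qed.

Definition unit_on (D : {set I}) :=
  exists2 c, mem_pair c & forall i, i \in D -> ~~ (P i %| c).

Lemma unit_on_singleton i : unit_on (finset.set1 i).
Proof.
have [|m [Mm mi mP]] := @not_multiple (finset.set1 i).
  by apply/set0Pn; exists i; rewrite inE.
have [j ij] := mi i (set11 i); have [k [i' [kj]]] := mP j.
rewrite inE => /eqP-> ik.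
have [||||c Mc cE] := @mem_pair_coordinates m j k => //.
- by apply: contraNneq ij => ->; rewrite dvdn0.
- by apply: contraNneq ik => ->; rewrite dvdn0.
exists c => // i''; rewrite inE => /eqP ->.
rewrite /dvdn -(modn_dvdm c (P_dvd i)) cE modn_dvdm // -/(dvdn _ _).
by rewrite Euclid_dvdM // negb_or ij.
Qed.

(** For i in D \ S, the set D \ {i} has a unit c i; it is divisible by P i, since D
    itself has none. The product of these c i is a unit on S and vanishes
    modulo the other P i, and a power of it reduces the units to 1. *)
Lemma exists_idempotent_pair (D S : {set I}) : S \proper D ->
  (forall i, i \in D -> unit_on (D :\ i)) -> ~ unit_on D ->
  exists2 c, mem_pair c & forall i, i \in D -> c = (i \in S) %[mod P i].
Proof.
move=> SD Dunit DN.
have /fin_all_exists[c cP] : forall i, exists c, i \in D -> [/\ mem_pair c,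
    P i %| c & forall j, j \in D -> j != i -> ~~ (P j %| c)].
  move=> i; case: (boolP (i \in D)) => [iD|]; last by exists 0.
  have [c Mc cD] := Dunit i iD.
  have cj j : j \in D -> j != i -> ~~ (P j %| c).
    by move=> jD ji; apply: cD; rewrite !inE ji.
  exists c => _; split=> //; apply/negPn/negP => ic; apply: DN; exists c => // j jD.
  by have [->|] := eqVneq j i => //; apply: cj.
have /properP[sSD [i0 i0D i0S]] := SD.
have [Mc0 i0c c0] := cP i0 i0D.
(* The extra factor c i0, harmless on S, makes this a pair and not just a power. *)
pose e := (\prod_(i in D :\: S) c i) * c i0.
have Me : mem_pair e.
  apply: mem_pair_scale => //; apply: mem_power_prod => i.
  by rewrite inE => /andP[_ /cP[/mem_pair_power]].
exists (e ^ N`!); first by apply: mem_pair_exp => //; exact: fact_gt0.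
move=> i iD; case: (boolP (i \in S)) => iS.
  apply: fermat_fact => //; first exact: dvdn_leq.
  rewrite /e Euclid_dvdM // negb_or; apply/andP; split; last first.
    by apply: c0 => //; apply: contraNneq i0S => <-.
  apply/negP => /(dvd_prime_prod (P_pr i))[j].
  rewrite inE => /andP[jS /cP[_ _ jc]]; apply/negP/jc => //.
  by apply: contraNneq jS => <-.
apply: dvdn_eqmod0; apply: dvdn_exp; first exact: fact_gt0.
by rewrite /e (bigD1 i) ?inE ?iS //= -mulnA dvdn_mulr //; case: (cP i iD).
Qed.

(** The induction on D described above: with phi distributing D over the variables
    of m and S v the share of v, the monomial put in x_v is the pair that
    vanishes outside S v, to a power inverse to the exponent of x_v. The
    contributions of the variables then add up to 1 modulo each P i. *)
Lemma unit_on_all D : unit_on D.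
Proof.
have [n] := ubnP #|D|; elim: n D => // n IHn D /ltnSE Dn.
apply: contrapT => DN.
have Dunit i : i \in D -> unit_on (D :\ i).
  by move=> iD; apply: IHn; apply: leq_trans Dn; rewrite (cardsD1 i D) iD.
have D1 i : D != finset.set1 i by apply/eqP => D1; apply: DN; rewrite D1;
  exact: unit_on_singleton.
have D0 : D != finset.set0.
  apply/eqP => D0; have [i _] := P_all (pdiv_prime N_gt1) (pdiv_dvd N).
  have [c Mc _] := unit_on_singleton i.
  by apply: DN; exists c => // j; rewrite D0 inE.
have [m [Mm mD mP]] := not_multiple D0.
(* The distribution phi is not constant on D, so that each share S v is proper. *)
have [phi phiP phiN] : exists2 phi : I -> nat,
    forall i, i \in D -> ~~ (P i %| expo m (phi i)) &
    forall v, exists2 i, i \in D & phi i != v.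
  have /fin_all_exists[phi phiP] :
      forall i, exists v, i \in D -> ~~ (P i %| expo m v).
    move=> i; case: (boolP (i \in D)) => [/mD[v iv]|_]; last by exists 0.
    by exists v.
  have [phiN|] := pselect (forall v, exists2 i, i \in D & phi i != v).
    by exists phi.
  move=> /existsNP[v /forall2NP phiv].
  have {}phiv i : i \in D -> phi i = v.
    by move=> iD; case: (phiv i) => [/(_ iD)|/negP/negPn/eqP].
  (* All of D was sent to v: move one element to another variable. It remains
     nonconstant because D has a second element. *)
  have [k [i1 [kv i1D i1k]]] := mP v.
  have [i2 i2D i21] : exists2 i2, i2 \in D & i2 != i1.
    apply: contrapT => Di; have /eqP := D1 i1; apply.
    apply/setP => i; rewrite inE; apply/idP/eqP => [iD|->//].
    by apply/eqP/negPn/negP => ii1; apply: Di; exists i.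
  exists (fun i => if i == i1 then k else phi i) => [i iD|w].
    by case: eqP => [->|_] //; exact: phiP.
  have [->|wv] := eqVneq w v; first by exists i1; rewrite ?eqxx.
  by exists i2; rewrite // (negPf i21) phiv // eq_sym.
pose S v := [set i in D | phi i == v]%SET.
have SD v : S v \proper D.
  apply/properP; split; first by apply/fintype.subsetP => i; rewrite inE => /andP[].
  by have [i iD iv] := phiN v; exists i; rewrite // inE iD.
have [s sP] : exists s : nat -> nat, forall v,
    mem_power (s v) /\ s v = expo m v %[mod N].
  have /choice[s sP] : forall v, exists s, mem_power s /\ s = expo m v %[mod N].
    by move=> v; have [s] := coordinate_power v Mm; exists s.
  by exists s.
have [c cP] : exists c : nat -> nat, forall v,
    mem_pair (c v) /\ forall i, i \in D -> c v = (i \in S v) %[mod P i].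
  have /choice[c cP] : forall v, exists c, mem_pair c /\
      forall i, i \in D -> c = (i \in S v) %[mod P i].
    by move=> v; have [c] := exists_idempotent_pair (SD v) Dunit DN; exists c.
  by exists c.
pose e v := s v ^ (N`!).-1 * c v.
have Me v : mem_pair (e v).
  by apply: mem_pair_scale; [case: (cP v)|apply: mem_power_exp; case: (sP v)].
apply: DN; exists (\sum_(v < arity m) expo m v * e v); first exact: mem_pair_sum.
move=> i iD; suff eP : \sum_(v < arity m) expo m v * e v = 1 %[mod P i].
  by rewrite /dvdn eP modn_small ?prime_gt1.
have phim : phi i < arity m.
  by apply: arity_gt; apply: contraNneq (phiP i iD) => ->; rewrite dvdn0.
have sPi v : s v = expo m v %[mod P i].
  by rewrite -(modn_dvdm (s v) (P_dvd i)) (sP v).2 modn_dvdm.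
(* Modulo P i, s v is the exponent of x_v, so s v ^ (N!).-1 is its inverse
   whenever it is invertible. *)
have term v : expo m v * e v = expo m v ^ N`! * (i \in S v) %[mod P i].
  rewrite /e mulnA -modnMmr ((cP v).2 i iD) modnMmr.
  suff h : expo m v * s v ^ (N`!).-1 = expo m v ^ N`! %[mod P i].
    by rewrite -modnMml h modnMml.
  by rewrite -modnMmr -modnXm sPi modnXm modnMmr -expnS prednK // fact_gt0.
transitivity ((\sum_(v < arity m) expo m v ^ N`! * (i \in S v)) %% P i).
  by apply: eq_mod_sum => v; exact: term.
rewrite (bigD1 (Ordinal phim)) // big1 => [|v vi]; last first.
  by rewrite inE iD eq_sym (negPf (vi : (v != phi i :> nat))) muln0.
rewrite /= addn0 inE iD eqxx muln1.
apply: fermat_fact; [exact: P_pr|by rewrite dvdn_leq|exact: phiP].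
Qed.

Lemma mem_xy : mem_expo M (nth 0 [:: 1; 1]).
Proof.
have [c Mc cP] := unit_on_all [set: I]%SET.
have cN : coprime c N.
  apply: contrapT => /negP cN; have g1 : 1 < gcdn c N.
    by rewrite ltn_neqAle eq_sym cN gcdn_gt0 N_gt0 orbT.
  have [i iE] := P_all (pdiv_prime g1) (dvdn_trans (pdiv_dvd _) (dvdn_gcdr c N)).
  have /negP := cP i (finset.in_setT i); apply; rewrite iE.
  exact: dvdn_trans (pdiv_dvd _) (dvdn_gcdl c N).
apply: (mem_equiv MC (mem_pair_exp (k := totient N) Mc _)).
  by rewrite totient_gt0.
have cE : exp_equiv N 1 (c ^ totient N).
  apply: exp_equiv_pos => //; first by rewrite expn_gt0 mem_pair_gt0.
  by rewrite Euler_exp_totient.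
by move=> [|[|j]].
Qed.

End Completeness.

End ProperClones.

(** * The candidates are the coatoms *)

Section Coatoms.

Local Open Scope classical_set_scope.
Local Open Scope nat_scope.

Lemma total_nth m s : expo m =1 nth 0 s -> total_degree m = sumn s.
Proof.
move=> mE; rewrite -(@total_widen m (size s)); last first.
  by apply/arity_leP => i si; rewrite mE nth_default.
by rewrite sumnE (big_nth 0) big_mkord; apply: eq_bigr.
Qed.

Lemma exists_nth s : has (fun e => e != 0) s -> exists m, expo m =1 nth 0 s.
Proof.
by move=> /mono_singleton[m mE]; exists m; change (mono s m); rewrite mE.
Qed.

Section Antichain.

Variables (I : finType) (P : I -> nat).
Hypothesis P_pr : forall i, prime (P i).
Hypothesis P_inj : injective P.

Lemma total_clone_sub d d' : total_clone d `<=` total_clone d' -> d' %| d.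
Proof.
move=> dd'; have [|m mE] := @exists_nth (nseq (1 + d) 1); first by [].
have mt : total_degree m = d.+1 by rewrite (total_nth mE) sumn_nseq mul1n.
have : total_clone d' m by apply: dd'; rewrite /total_clone /= mt -add1n modnDr.
by rewrite /total_clone /= mt => /eqP; rewrite eqn_mod_dvd // subn1.
Qed.

Lemma total_clone_not_sub d (D : {set I}) : 0 < d -> D != finset.set0 ->
  ~ (total_clone d `<=` multiple_clone P D).
Proof.
move=> d0 /set0Pn[i0 i0D] dD.
have [|m mE] := @exists_nth (nseq (1 + d) 1); first by [].
have m1 j : j < 2 -> expo m j = 1.
  by move=> j2; rewrite mE nth_nseq add1n (leq_trans j2).
have P1 i : ~~ (P i %| 1) by rewrite dvdn1 neq_ltn prime_gt1 ?orbT.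
have [|[i _ im]|[j mj]] := dD m.
- by rewrite /total_clone /= (total_nth mE) sumn_nseq mul1n modnDr.
- by have := P1 i; rewrite -(m1 0) // im.
- have := P1 i0; have [j0|j0] := eqVneq j 0.
    by rewrite -(m1 1) // mj // j0.
  by rewrite -(m1 0) // mj // eq_sym.
Qed.

Lemma multiple_clone_not_sub p (D : {set I}) : prime p ->
  ~ (multiple_clone P D `<=` total_clone p).
Proof.
move=> p_pr Dp; have [|m mE] := @exists_nth [:: p].
  by rewrite /= -lt0n prime_gt0.
have : total_clone p m.
  by apply: Dp; right; exists 0 => -[|k] // _ i _; rewrite mE /= ?nth_nil.
by rewrite /total_clone /= (total_nth mE) /= addn0 modnn modn_small ?prime_gt1.
Qed.

(** Compare on the monomials x_1^(P i) x_2^(P i), which force P i into D', and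
    x_1 x_2^T, which forces D' into D. *)
Lemma multiple_clone_sub (D D' : {set I}) : D != finset.set0 -> D' != finset.set0 ->
  multiple_clone P D `<=` multiple_clone P D' -> D = D'.
Proof.
move=> /set0Pn[i0 i0D] /set0Pn[k0 k0D'] DD'.
have P1 i : ~~ (P i %| 1) by rewrite dvdn1 neq_ltn prime_gt1 ?orbT.
have PP i j : P i %| P j -> i = j.
  by rewrite dvdn_prime2 ?P_pr // => /eqP/P_inj.
apply/eqP; rewrite finset.eqEsubset; apply/andP.
split; apply/fintype.subsetP => i iD.
  have [|m mE] := @exists_nth [:: P i; P i]; first by rewrite /= -lt0n prime_gt0.
  have [|[k kD' /(_ 0)]|[j mj]] := DD' m.
  - by left; exists i => // -[|[|j]]; rewrite mE /= ?nth_nil ?dvdn0.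
  - by rewrite mE => /PP <-.
  - suff /PP <- : P k0 %| P i by [].
    by case: j mj => [/(_ 1)|j /(_ 0)]; rewrite mE => /(_ isT _ k0D').
have [|m mE] := @exists_nth [:: 1; \prod_(i in D) P i]; first by [].
have [|[k kD' /(_ 0)]|[j mj]] := DD' m.
- right; exists 0 => -[|[|j]] // _ k kD; rewrite mE /= ?nth_nil //.
  by rewrite (bigD1 k) //= dvdn_mulr.
- by rewrite mE => /negPn; rewrite P1.
- case: j mj => [/(_ 1)|j /(_ 0)]; rewrite mE => /(_ isT i iD) /=.
    by move=> /(dvd_prime_prod (P_pr i))[k kD /PP ->].
  by move=> /negPn; rewrite P1.
Qed.

End Antichain.

Section Family.

Variables (F : finFieldType) (l : nat) (P : 'I_l -> nat).
Local Notation N := #|F|.-1.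
Hypothesis N_gt1 : 1 < N.
Hypothesis P_inj : injective P.
Hypothesis P_pr : forall i, prime (P i).
Hypothesis P_dvd : forall i, P i %| N.
Hypothesis P_all : forall p, prime p -> p %| N -> exists i, P i = p.

Definition maximal_family (C : set monomial) : Prop :=
  (exists i, C = total_clone (P i)) \/
  (exists2 D : {set 'I_l}, D != finset.set0 & C = multiple_clone P D).

Lemma NablaE : Nabla F = setT.
Proof.
rewrite -total_clone1 -(@total_clone_generated N 1) ?dvd1n //.
exact: generated_smallest.
Qed.

Lemma maximal_family_clone C : maximal_family C -> monomial_clone F C.
Proof.
case=> [[i ->]|[D D0 ->]]; apply/monomial_cloneP; first exact: total_cloneP.
exact: multiple_cloneP.
Qed.

Lemma maximal_family_antichain C C' : maximal_family C -> maximal_family C' ->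
  C `<=` C' -> C = C'.
Proof.
case=> [[i ->]|[D D0 ->]] [[j ->]|[D' D'0 ->]].
- move=> /total_clone_sub; rewrite dvdn_prime2 ?P_pr // => /eqP ->; by [].
- by move=> /total_clone_not_sub; case; rewrite ?prime_gt0.
- by move=> /multiple_clone_not_sub; case.
- by move=> /multiple_clone_sub ->.
Qed.

Lemma maximal_family_above M : monomial_clone F M -> M <> setT ->
  exists2 C, maximal_family C & M `<=` C.
Proof.
move=> /monomial_cloneP MC MT; apply: contrapT => MN; apply: MT.
have Mxy : mem_expo M (nth 0 [:: 1; 1]).
  apply: (@mem_xy N M (ltnW N_gt1) MC N_gt1 _ P) => // [i|D D0] MK; apply: MN.
    by exists (total_clone (P i)) => //; left; exists i.
  by exists (multiple_clone P D) => //; right; exists D.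
apply/seteqP; split=> // m _.
have [s [s_size mE]] := multiset_of_monomial m.
apply/mem_expoP; apply: (@mem_expo_ext _ (fun j => count_mem j s)) => //.
apply: (@mem_count_mem N M 1 s (size s).-1) => //.
by rewrite muln1 add1n prednK // s_size total_gt0.
Qed.

Lemma maximal_family_neqT C : maximal_family C -> C <> setT.
Proof.
have [i _] := P_all (pdiv_prime N_gt1) (pdiv_dvd N).
have i0 : finset.set1 i != finset.set0 by apply/set0Pn; exists i; rewrite inE.
case=> [[j ->]|[D D0 ->]] CT.
- have := @multiple_clone_not_sub _ P _ (finset.set1 i) (P_pr j).
  by rewrite CT; apply.
- have := @total_clone_not_sub _ P P_pr _ D (prime_gt0 (P_pr i)) D0.
  by rewrite CT; apply.
Qed.

(** Delta lies below every clone, so by the antichain property it could belong to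
    the family only if the family had a single element. *)
Lemma maximal_family_neqDelta C : maximal_family C -> C <> Delta F.
Proof.
have [i _] := P_all (pdiv_prime N_gt1) (pdiv_dvd N).
have i0 : finset.set1 i != finset.set0 by apply/set0Pn; exists i; rewrite inE.
move=> CF CD.
have least K : maximal_family K -> C `<=` K.
  move=> KF; rewrite CD; apply: smallest_sub; first exact: maximal_family_clone.
  have /maximal_family_clone/monomial_cloneP[Kx _] := KF.
  by move=> m mE; apply: (Kx 0) => -[|j]; rewrite mE //= ?nth_nil.
have tF : maximal_family (total_clone (P i)) by left; exists i.
have mF : maximal_family (multiple_clone P (finset.set1 i)).
  by right; exists (finset.set1 i).
have := @total_clone_not_sub _ P P_pr _ _ (prime_gt0 (P_pr i)) i0; apply.
by rewrite -(maximal_family_antichain CF tF (least _ tF)); exact: least.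
Qed.

Lemma coatomP C : coatom F C <-> maximal_family C.
Proof.
rewrite /coatom NablaE; split=> [[CC _ CT Cmax]|CF].
  have [K KF CK] := maximal_family_above CC CT.
  have [KT|<- //] := Cmax K (maximal_family_clone KF) CK.
  by case: (maximal_family_neqT KF).
split; [exact: maximal_family_clone|exact: maximal_family_neqDelta|
  exact: maximal_family_neqT|].
move=> D DC CD; have [->|/(maximal_family_above DC)[K KF DK]] := pselect (D = setT).
  by left.
have CK := maximal_family_antichain CF KF (subset_trans CD DK).
by right; apply/seteqP; split=> //; rewrite CK.
Qed.

End Family.

End Coatoms.

Theorem theorem5p10 (F : finFieldType) (q : nat) (Fq : #|F| = q) (q_gt2 : 2 < q)
    (l : nat) (P : 'I_l -> nat)
    (P_incr : forall i j : 'I_l, i < j -> P i < P j)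
    (P_primes : forall p : nat, prime p && (p %| q - 1) <-> exists i, P i = p)
    (C : set monomial) :
  coatom F C <->
    (exists i : 'I_l, C = generated F (mono (nseq (1 + P i) 1))) \/
    (exists D : {set 'I_l}, D != finset.set0 /\ C = Sclone F P D).
Proof.
have NE : #|F|.-1 = q - 1 by rewrite Fq subn1.
have P_prime i : prime (P i) /\ P i %| #|F|.-1.
  by apply/andP; rewrite NE P_primes; exists i.
have P_pr i := (P_prime i).1; have P_dvd i := (P_prime i).2.
have P_all p : prime p -> p %| #|F|.-1 -> exists i, P i = p.
  by move=> p_pr pN; apply/P_primes; rewrite p_pr -NE.
have P_inj : injective P.
  move=> i j Pij; apply/val_inj; case: (ltngtP i j) => // /P_incr.
    by rewrite Pij ltnn.
  by rewrite Pij ltnn.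
have N_gt1 : 1 < #|F|.-1 by rewrite NE subn1 -ltnS prednK // (ltn_trans _ q_gt2).
have totalE i : generated F (mono (nseq (1 + P i) 1)) = total_clone (P i).
  by rewrite generated_smallest total_clone_generated // prime_gt0.
have multipleE (D : {set 'I_l}) : D != finset.set0 ->
    Sclone F P D = multiple_clone P D.
  by move=> D0; rewrite -(multiple_clone_generated D0 (fun i _ => P_pr i) P_inj
    (fun i _ => P_dvd i)) -generated_smallest.
rewrite (coatomP N_gt1 P_inj P_pr P_dvd P_all).
split=> [[[i ->]|[D D0 ->]]|[[i ->]|[D [D0 ->]]]].
- by left; exists i.
- by right; exists D; rewrite multipleE.
- by rewrite totalE; left; exists i.
- by rewrite multipleE //; right; exists D.
Qed.
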